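(* Let $(X,{\leq})$ be a linearly ordered set. A topological subgroup $G$ of $\mathrm{Aut}(X,{\leq})$ is skew-amenable if and only if, for every finite subset $S \subseteq X$, there exists a $G$-invariant mean on $\ell^{\infty}(\{ gS \mid g \in G \})$.
   Context: For a topological group $G$ and $g\in G$ let $\lambda_g\colon G\to G,\ x\mapsto gx$. Let $\mathrm{LUCB}(G)$ be the algebra of all bounded functions $f\colon G\to\mathbb{R}$ that are left-uniformly continuous, i.e., for every $\epsilon>0$ there is a neighborhood $U$ of the neutral element with $|f(x)-f(y)|\le\epsilon$ whenever $x,y \in G$ and $x^{-1}y\in U$. A mean on a linear subspace $A\subseteq\ell^\infty(Z)$ containing the constant function $\mathbf 1$ ($Z$ a set, $\ell^\infty(Z)$ the bounded real-valued functions) is a positive linear functional $\mu\colon A\to\mathbb{R}$ with $\mu(\mathbf 1)=1$. The group $G$ is skew-amenable if $\mathrm{LUCB}(G)$ admits a left-invariant mean, i.e., a mean $\mu$ with $\mu(f\circ\lambda_g)=\mu(f)$ for all $f\in\mathrm{LUCB}(G)$, $g\in G$. $\mathrm{Aut}(X,{\leq})$ is the group of order-automorphisms of $(X,\le)$, with the topology of pointwise convergence arising from the discrete topology on $X$ (pointwise stabilizers of finite subsets form a neighborhood basis of the identity); a topological subgroup is a subgroup with the subspace topology. For $g\in G$ and $S\subseteq X$, $gS=\{gx\mid x\in S\}$; this defines an action of $G$ on the power set of $X$. A mean $\mu$ on $\ell^\infty(Y)$, for a $G$-set $Y$, is $G$-invariant if $\mu(f\circ\alpha_g)=\mu(f)$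 for all $f\in\ell^\infty(Y)$ and $g\in G$, where $\alpha_g(y)=gy$. *)

(* Defs.v *)
From HB Require Import structures.
From mathcomp Require Import all_boot all_order all_algebra.
From mathcomp Require Import all_classical all_reals.
From mathcomp Require Import topology normedtype.

Set Implicit Arguments.
Unset Strict Implicit.
Unset Printing Implicit Defensive.

Import Order.TTheory GRing.Theory Num.Theory.
Import numFieldNormedType.Exports.

Local Open Scope classical_set_scope.
Local Open Scope ring_scope.

HB.structure Definition PreTopologicalGroup :=
  {G of Topological G & Group G}.

HB.mixin Record PreTopologicalGroup_isTopologicalGroup G
    of PreTopologicalGroup G := {
  mulg_continuous : continuous (fun x : G * G => (x.1 * x.2)%g);
  invg_continuous : continuous (fun x : G => (x^-1)%g)
}.

#[short(type="topologicalGroupType")]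
HB.structure Definition TopologicalGroup :=
  {G of PreTopologicalGroup G & PreTopologicalGroup_isTopologicalGroup G}.

Section Subgroup.
Variables (T : topologicalGroupType) (G : groupClosed T).

Definition subgroup : Type := {g : T | g \in G}.

Definition subgroup_val (g : subgroup) : T := sval g.

HB.instance Definition _ := [isSub for subgroup_val].
HB.instance Definition _ := [Choice of subgroup by <:].

Let subgroup_closed : group_closed G.
Proof. by split; [exact: gpred1 | move=> x y Gx Gy; exact: gpredF]. Qed.

HB.instance Definition _ :=
  @SubChoice_isSubGroup.Build T (fun g => g \in G) subgroup subgroup_closed.
HB.instance Definition _ :=
  Topological.copy subgroup (initial_topology subgroup_val).

Let val_continuous : continuous subgroup_val.
Proof. exact: initial_continuous. Qed.

Let subgroup_mulg_continuous :
  continuous (fun x : subgroup * subgroup => (x.1 * x.2)%g).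
Proof.
apply: continuous_comp_initial => -[x y].
apply: (@continuous_comp _ _ _
  (fun z : subgroup * subgroup => (subgroup_val z.1, subgroup_val z.2))
  (fun z : T * T => (z.1 * z.2)%g)); last exact: mulg_continuous.
apply: cvg_pair => /=.
- by apply: (cvg_comp _ _ cvg_fst); exact: val_continuous.
- by apply: (cvg_comp _ _ cvg_snd); exact: val_continuous.
Qed.

Let subgroup_invg_continuous : continuous (fun x : subgroup => (x^-1)%g).
Proof.
apply: continuous_comp_initial => x.
apply: (@continuous_comp _ _ _ subgroup_val (fun z : T => (z^-1)%g)).
  exact: val_continuous.
exact: invg_continuous.
Qed.

HB.instance Definition _ := PreTopologicalGroup_isTopologicalGroup.Build
  subgroup subgroup_mulg_continuous subgroup_invg_continuous.

End Subgroup.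

Section OrderAut.
Variables (d : Order.disp_t) (X : orderType d).

Definition order_automorphisms : set {ptws X -> discrete_topology X} :=
  [set f | bijective f /\ {mono (f : X -> X) : x y / (x <= y)%O}].

(* Subspace topology inherited from X ^ X, with X discrete. *)
Definition order_aut : Type := set_type order_automorphisms.

HB.instance Definition _ :=
  Topological.copy order_aut (set_type order_automorphisms).

Definition order_aut_fun (g : order_aut) : X -> X := \val g.

Coercion order_aut_fun : order_aut >-> Funclass.

Lemma order_aut_bij (g : order_aut) : bijective g.
Proof. by have [] := set_valP g. Qed.

Lemma order_aut_mono (g : order_aut) : {mono g : x y / (x <= y)%O}.
Proof. by have [] := set_valP g. Qed.

Lemma order_aut_ext (g h : order_aut) : g =1 h -> g = h.
Proof. by move=> gh; apply/val_inj/funext. Qed.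

Let one_subproof : order_automorphisms id.
Proof. by split=> //; exists id. Qed.

Definition order_aut_one : order_aut := SigSub (mem_set one_subproof).

Let mul_subproof (g h : order_aut) : order_automorphisms (g \o h).
Proof.
split; first by apply: bij_comp; exact: order_aut_bij.
by move=> x y /=; rewrite !order_aut_mono.
Qed.

Definition order_aut_mul (g h : order_aut) : order_aut :=
  SigSub (mem_set (mul_subproof g h)).

Let inv_ex (g : order_aut) : {f : X -> X | cancel g f & cancel f g}.
Proof. by apply: cid2; have [f gf fg] := order_aut_bij g; exists f. Qed.

Let inv_fun (g : order_aut) : X -> X := s2val (inv_ex g).

Let inv_funK (g : order_aut) : cancel g (inv_fun g).
Proof. exact: (s2valP (inv_ex g)). Qed.

Let inv_funVK (g : order_aut) : cancel (inv_fun g) g.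
Proof. exact: (s2valP' (inv_ex g)). Qed.

Let inv_subproof (g : order_aut) : order_automorphisms (inv_fun g).
Proof.
split; first by exists g.
by move=> x y; rewrite -(order_aut_mono g) !inv_funVK.
Qed.

Definition order_aut_inv (g : order_aut) : order_aut :=
  SigSub (mem_set (inv_subproof g)).

Let mulA : associative order_aut_mul.
Proof. by move=> f g h; exact: order_aut_ext. Qed.
Let mul1 : left_id order_aut_one order_aut_mul.
Proof. by move=> g; exact: order_aut_ext. Qed.
Let mulr1 : right_id order_aut_one order_aut_mul.
Proof. by move=> g; exact: order_aut_ext. Qed.
Let mulV : left_inverse order_aut_one order_aut_inv order_aut_mul.
Proof. by move=> g; apply: order_aut_ext => x; exact: inv_funK. Qed.
Let mulrV : right_inverse order_aut_one order_aut_inv order_aut_mul.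
Proof. by move=> g; apply: order_aut_ext => x; exact: inv_funVK. Qed.

HB.instance Definition _ :=
  isGroup.Build order_aut mulA mul1 mulr1 mulV mulrV.

Lemma order_aut1E x : (1%g : order_aut) x = x. Proof. by []. Qed.

Lemma order_autME (g h : order_aut) x : (g * h : order_aut)%g x = g (h x).
Proof. by []. Qed.

Lemma order_autK (g : order_aut) : cancel g (g^-1 : order_aut)%g.
Proof. exact: inv_funK. Qed.

Lemma order_autVK (g : order_aut) : cancel (g^-1 : order_aut)%g g.
Proof. exact: inv_funVK. Qed.

Lemma near_order_aut (g : order_aut) (x : X) :
  nbhs g [set h : order_aut | h x = g x].
Proof.
have cv : continuous
    (order_aut_fun : order_aut -> {ptws X -> discrete_topology X}).
  exact: initial_continuous.
have cx := @proj_continuous X (fun=> discrete_topology X) x.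
exact: (cv g _ (cx (g : X -> X) _ (@discrete_set1 (discrete_topology X) _))).
Qed.

Lemma cvg_order_aut (F : set_system order_aut) (g : order_aut) : Filter F ->
  (forall x, F [set h : order_aut | h x = g x]) -> F --> g.
Proof.
move=> FF Fg U [V [[W oW <-]] /= Wg /filterS]; apply.
suff FW : (order_aut_fun @ F : set_system {ptws X -> discrete_topology X})
    --> (g : {ptws X -> discrete_topology X}).
  by apply: FW; exact: open_nbhs_nbhs.
apply/cvg_sup => x; apply/cvg_image.
  by rewrite eqEsubset; split=> // y _; exists (fun=> y).
move=> A /principal_filterP Ax; exists (proj x @^-1` A).
  by rewrite /= nbhs_simpl /=; apply: filterS (Fg x) => h /= hx; rewrite /proj hx.
by rewrite eqEsubset; split=> [y [f fA <-]//|y Ay]; exists (fun=> y).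
Qed.

Lemma nbhs_order_aut (g : order_aut) (U : set order_aut) :
  nbhs g U <-> exists2 F : set X, finite_set F &
    [set h : order_aut | {in F, h =1 g}] `<=` U.
Proof.
split=> [gU|[F Ffin sFU]]; last first.
  apply: filterS sFU _.
  suff -> : [set h : order_aut | {in F, h =1 g}] =
      \bigcap_(x in F) [set h : order_aut | h x = g x].
    have [D ->] := finite_fsetP.1 Ffin.
    by apply: filter_bigI => x _; exact: near_order_aut.
  by apply/seteqP; split=> h /= hF x xF; [exact/hF/mem_set | exact/hF/set_mem].
pose N : set_system order_aut := filter_from finite_set
  (fun F => [set h : order_aut | {in F, h =1 g}]).
have FN : Filter N.
  apply: filter_from_filter; first by exists set0; exact: finite_set0.
  move=> F1 F2 fin1 fin2; exists (F1 `|` F2).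
    by rewrite finite_setU.
  move=> h /= hF; split=> x /set_mem xF; apply/hF/mem_set; [by left|by right].
suff Ng : N --> g by exact: Ng _ gU.
apply: cvg_order_aut => x; exists [set x]; first exact: finite_set1.
by move=> h /=; apply; exact/mem_set.
Qed.

Let order_aut_mulg_continuous :
  continuous (fun x : order_aut * order_aut => (x.1 * x.2)%g).
Proof.
move=> [/= g h]; apply: cvg_order_aut => x.
pose g0 : order_aut := g; pose h0 : order_aut := h.
exists ([set k : order_aut | k (h0 x) = g0 (h0 x)],
        [set k : order_aut | k x = h0 x]).
  by split; exact: near_order_aut.
by move=> [k l] /= [kg lh]; rewrite !order_autME lh kg.
Qed.

Let order_aut_invg_continuous : continuous (fun x : order_aut => (x^-1)%g).
Proof.
move=> g; have Fg : Filter ((fun x : order_aut => (x^-1)%g) @ g).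
  exact: (@fmap_filter _ _ _ _ (nbhs_filter g)).
apply: (cvg_order_aut Fg) => x.
pose g0 : order_aut := g.
have := near_order_aut g0 ((g0^-1 : order_aut)%g x).
apply: filterS => h /=.
by rewrite order_autVK => /(canRL (order_autK h)) ->.
Qed.

HB.instance Definition _ := PreTopologicalGroup_isTopologicalGroup.Build
  order_aut order_aut_mulg_continuous order_aut_invg_continuous.

End OrderAut.

Section Means.
Variable R : realType.

(* The values of [mu] outside [A] are irrelevant: [mu] encodes a functional
   on the linear subspace [A]. *)
Definition is_mean (Z : Type) (A : set (Z -> R)) (mu : (Z -> R) -> R) : Prop :=
  [/\ forall (c : R) (f g : Z -> R), A f -> A g ->
         mu (c *: f + g) = c * mu f + mu g,
      forall f : Z -> R, A f -> (forall z, 0 <= f z) -> 0 <= mu f &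
      mu (cst 1) = 1].

Definition linfty (Z : Type) : set (Z -> R) := bounded_fun.

Lemma linftyP (Z : Type) (f : Z -> R) :
  linfty f <-> exists M : R, forall z, `|f z| <= M.
Proof.
split=> [[M [Mreal fM]]|[M fM]].
  by exists (M + 1) => z; apply: fM => //; rewrite ltrDl.
exists M; split; first exact: num_real.
by move=> N /ltW MN z _; exact: le_trans MN.
Qed.

Definition LUCB (G : topologicalGroupType) : set (G -> R) :=
  [set f | linfty f /\ forall e : R, 0 < e ->
     exists2 U : set G, nbhs (1%g : G) U &
       forall x y : G, U (x^-1 * y)%g -> `|f x - f y| <= e].

Definition skew_amenable (G : topologicalGroupType) : Prop :=
  exists2 mu : (G -> R) -> R, is_mean (@LUCB G) mu &
    forall f : G -> R, LUCB f -> forall g : G,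
      mu (fun x => f (g * x)%g) = mu f.

End Means.

Record group_action (G : groupType) (Y : Type) := GroupAction {
  act :> G -> Y -> Y ;
  act1 : forall y, act 1%g y = y ;
  actM : forall g h y, act (g * h)%g y = act g (act h y)
}.

Definition invariant_mean (R : realType) (G : groupType) (Y : Type)
    (a : group_action G Y) (mu : (Y -> R) -> R) : Prop :=
  is_mean (@linfty R Y) mu /\
  forall f : Y -> R, linfty f -> forall g : G, mu (f \o a g) = mu f.

Section ActionConstructions.
Variable G : groupType.

Section Powerset.
Variables (Y : Type) (a : group_action G Y).

Let powerset_act (g : G) (S : set Y) : set Y := a g @` S.

Let powerset_act1 S : powerset_act 1%g S = S.
Proof.
by rewrite /powerset_act (_ : a 1%g = id) ?image_id//; apply/funext/act1.
Qed.

Let powerset_actM g h S :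
  powerset_act (g * h)%g S = powerset_act g (powerset_act h S).
Proof.
rewrite /powerset_act image_comp; congr (_ @` _).
by apply/funext => y; exact: actM.
Qed.

Definition powerset_action : group_action G (set Y) :=
  GroupAction powerset_act1 powerset_actM.

End Powerset.

Section Orbit.
Variables (Y : Type) (a : group_action G Y) (y0 : Y).

Definition act_orbit : set Y := [set a g y0 | g in setT].

Let orbit_subproof (g : G) (y : act_orbit) : act_orbit (a g (\val y)).
Proof. by have [h _ <-] := set_valP y; exists (g * h)%g => //; exact: actM. Qed.

Let orbit_act (g : G) (y : act_orbit) : act_orbit :=
  SigSub (mem_set (orbit_subproof g y)).

Let orbit_act1 y : orbit_act 1%g y = y.
Proof. by apply: eq_sig_hprop => //=; exact: act1. Qed.

Let orbit_actM g h y : orbit_act (g * h)%g y = orbit_act g (orbit_act h y).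
Proof. by apply: eq_sig_hprop => //=; exact: actM. Qed.

Definition orbit_action : group_action G act_orbit :=
  GroupAction orbit_act1 orbit_actM.

End Orbit.

End ActionConstructions.

Definition order_aut_action (d : Order.disp_t) (X : orderType d)
    (G : groupClosed (order_aut X)) : group_action (subgroup G) X :=
  @GroupAction (subgroup G) X (fun g => order_aut_fun (subgroup_val g))
    (fun=> erefl) (fun _ _ _ => erefl).

(* Main.v *)
Require Import Defs.
From mathcomp Require Import all_boot all_order all_algebra.
From mathcomp Require Import all_classical all_reals.
From mathcomp Require Import topology normedtype finmap.

Set Implicit Arguments.
Unset Strict Implicit.
Unset Printing Implicit Defensive.

Import Order.TTheory GRing.Theory Num.Theory.
Import numFieldNormedType.Exports.

Local Open Scope classical_set_scope.
Local Open Scope ring_scope.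

(** An automorphism of a linear order that maps a finite set [S] onto itself
    fixes every point of [S].  So the orbit of [S] under [G] is the coset space
    of [G] modulo the pointwise stabilizer of [S], and these stabilizers form a
    neighborhood basis of [1].  A left-uniformly continuous function is one
    that is almost constant on the left cosets of such a stabilizer, hence
    almost a function on an orbit of finite sets.

    For the forward direction, pulling a bounded function on the orbit of [S]
    back along [g |-> gS] yields a left-uniformly continuous function
    ([linfty_orbit_LUCB]), and the pullback commutes with the action; an
    invariant mean on [LUCB G] thus pushes forward to an invariant mean on the
    orbit.

    For the converse, choose for each point [y] of the orbit of [S] some [g]
    with [gS = y] and push an invariant mean on the orbit forward along this
    section.  The result is a mean [m_S] on all bounded functions on [G].  The
    section is equivariant only up to the stabilizer of [S], so if [f] varies
    by at most [e] on the left cosets of the stabilizer of [F], then [m_S]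
    changes by at most [e] under left translation of [f] as soon as [S]
    contains [F] ([mean_orbit_repr_almost_invariant]).  A limit of the [m_S]
    along an ultrafilter that refines the growing finite sets [S]
    ([mean_limit]) is therefore exactly invariant on [LUCB G]. *)

(** * Means and their limits *)

Lemma ultrafilter_fmap (S T : Type) (f : S -> T) (U : set_system S) :
  UltraFilter U -> UltraFilter (f @ U).
Proof.
move=> UU; split=> [|H HH UH]; first exact: fmap_proper_filter.
apply/seteqP; split=> [A HA|]; last exact: UH.
have [//|UnA] := in_ultra_setVsetC (f @^-1` A) UU.
have HnA : H (~` A) by exact: UH.
suff /(@filter_not_empty _ _ HH) : H set0 by [].
by rewrite -(setICr A); exact: filterI.
Qed.

Section MeanTheory.
Variable R : realType.
Implicit Types Y Z : Type.

(** Used for both directions of the theorem: from [LUCB] to an orbit, and from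
    an orbit to the group. *)
Lemma is_mean_pushforward Y Z (A : set (Y -> R)) (B : set (Z -> R))
    (s : Y -> Z) (mu : (Y -> R) -> R) :
  (forall f, B f -> A (f \o s)) -> is_mean A mu ->
  is_mean B (fun f => mu (f \o s)).
Proof.
move=> BA [mulin mupos mu1]; split=> //.
- by move=> c f g Bf Bg; rewrite -mulin//; exact: BA.
- by move=> f Bf f0; apply: mupos => [|y]; [exact: BA | exact: f0].
Qed.

Lemma linfty_comp Y Z (s : Y -> Z) (f : Z -> R) : linfty f -> linfty (f \o s).
Proof. by rewrite !linftyP => -[M fM]; exists M => y; exact: fM. Qed.

Lemma linfty_cst Z (c : R) : linfty (cst c : Z -> R).
Proof. by apply/linftyP; exists `|c|. Qed.

Lemma linfty_lin Z (c : R) (f g : Z -> R) :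
  linfty f -> linfty g -> linfty (c *: f + g).
Proof.
rewrite !linftyP => -[M fM] [N gN]; exists (`|c| * M + N) => z.
rewrite (le_trans (ler_normD _ _))// lerD// normrM.
by apply: ler_wpM2l.
Qed.

Lemma meanB Z (mu : (Z -> R) -> R) (f g : Z -> R) :
  is_mean (@linfty R Z) mu -> linfty f -> linfty g ->
  mu (f - g) = mu f - mu g.
Proof.
move=> [mulin _ _] bf bg.
have -> : f - g = -1 *: g + f by rewrite scaleN1r addrC.
by rewrite mulin// mulN1r addrC.
Qed.

Lemma mean_cst Z (mu : (Z -> R) -> R) (c : R) :
  is_mean (@linfty R Z) mu -> mu (cst c) = c.
Proof.
move=> mean_mu; have [mulin _ mu1] := mean_mu.
have b1 := linfty_cst Z 1.
have mu0 : mu (cst 1 - cst 1) = 0 by rewrite meanB// subrr.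
have -> : cst c = c *: cst 1 + (cst 1 - cst 1) :> (Z -> R).
  by apply/funext => z; rewrite subrr addr0; exact/esym/mulr1.
by rewrite mulin// ?mu0 ?mu1 ?mulr1 ?addr0// subrr; exact: linfty_cst.
Qed.

Lemma mean_le Z (mu : (Z -> R) -> R) (f g : Z -> R) :
  is_mean (@linfty R Z) mu -> linfty f -> linfty g ->
  (forall z, f z <= g z) -> mu f <= mu g.
Proof.
move=> mean_mu bf bg fg; have [_ mupos _] := mean_mu.
rewrite -subr_ge0 -meanB//; apply: mupos => [|z].
  by rewrite addrC -scaleN1r; exact: linfty_lin.
by rewrite subr_ge0; exact: fg.
Qed.

Lemma mean_norm_le Z (mu : (Z -> R) -> R) (f : Z -> R) (M : R) :
  is_mean (@linfty R Z) mu -> (forall z, `|f z| <= M) -> `|mu f| <= M.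
Proof.
move=> mean_mu fM; have bf : linfty f by apply/linftyP; exists M.
have le_mu := mean_le mean_mu.
rewrite ler_norml -{1}(mean_cst (- M) mean_mu) -{2}(mean_cst M mean_mu).
apply/andP; split; apply: le_mu => //; try exact: linfty_cst.
- by move=> z; have := fM z; rewrite ler_norml => /andP[].
- by move=> z; have := fM z; rewrite ler_norml => /andP[].
Qed.

Lemma ultra_bounded_cvg (I : Type) (U : set_system I) (u : I -> R) (M : R) :
  UltraFilter U -> (forall i, `|u i| <= M) -> cvg (u @ U).
Proof.
move=> UU uM; have := @segment_compact R (- M) M; rewrite compact_ultra.
move=> /= /(_ _ (ultrafilter_fmap u UU))[].
  apply: (@filterE _ U) => i /=; rewrite in_itv/= -ler_norml; exact: uM.
by move=> l [_ ul]; apply/cvg_ex; exists l.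
Qed.

(** Weak-* compactness of the set of means, in the form that is needed: a
    pointwise limit along an ultrafilter finer than [F] is again a mean, and it
    cannot separate two functions that the [m i] asymptotically identify. *)
Lemma mean_limit (I : Type) (F : set_system I) (Z : Type)
    (m : I -> (Z -> R) -> R) :
  ProperFilter F -> (forall i, is_mean (@linfty R Z) (m i)) ->
  exists2 mu : (Z -> R) -> R, is_mean (@linfty R Z) mu &
    forall f g : Z -> R, linfty f -> linfty g ->
      (forall e : R, 0 < e -> \forall i \near F, `|m i f - m i g| <= e) ->
      mu f = mu g.
Proof.
move=> FF mean_m; have [U [UU FU]] := ultraFilterLemma FF.
have cvg_m f : linfty f -> cvg (m^~ f @ U).
  move=> /linftyP[M fM]; apply: (ultra_bounded_cvg (M := M)) => i.
  exact: mean_norm_le.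
exists (fun f => lim (m^~ f @ U)); first split.
- move=> c f g bf bg; apply/cvg_lim => //.
  rewrite [X in X @ U](_ : _ = fun i => c * m i f + m i g); last first.
    by apply/funext => i; have [-> //] := mean_m i.
  apply: cvgD; last exact: cvg_m.
  by apply: cvgMr; exact: cvg_m.
- move=> f bf f0; apply: limr_ge; first exact: cvg_m.
  by apply: filterE => i; have [_ + _] := mean_m i; exact.
- apply/cvg_lim => //.
  rewrite [X in X @ U](_ : _ = cst 1); first exact: cvg_cst.
  by apply/funext => i; have [] := mean_m i.
move=> f g bf bg fg; apply/subr0_eq.
have : (fun i => m i f - m i g) @ U --> lim (m^~ f @ U) - lim (m^~ g @ U).
  by apply: cvgB; exact: cvg_m.
move=> /cvg_lim <- //; apply/cvg_lim => //.
apply/cvgr0Pnorm_le => e e0; apply: FU; exact: fg.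
Qed.

End MeanTheory.

(** * Finite sets under order automorphisms *)

Section FiniteStabilizer.
Variables (d : Order.disp_t) (X : orderType d).

(** The increasing enumeration of [S] is mapped to an increasing enumeration of
    [g @` S = S], and a finite set has only one such enumeration. *)
Lemma order_aut_fix_finite (g : order_aut X) (S : set X) :
  finite_set S -> g @` S = S -> forall x, S x -> g x = x.
Proof.
move=> /finite_seqP[s ->] gs x xs.
pose t := sort <=%O (undup s).
have ts : t =i s by move=> y; rewrite mem_sort mem_undup.
have t_sorted : sorted <%O t.
  rewrite lt_sorted_uniq_le sort_uniq undup_uniq.
  exact: sort_sorted (@le_total _ _) _.
have gt : map g t = t.
  apply: lt_sorted_eq => //.
    rewrite sorted_map; apply: sub_sorted t_sorted => y z /=.
    by rewrite (leW_mono (order_aut_mono g)).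
  have gsE y : ([set` s] y) <-> (g @` [set` s]) y by rewrite gs.
  move=> y; rewrite ts; apply/mapP/idP => [[z zt ->]|ys].
    by apply/gsE; exists z => //=; rewrite -ts.
  by have /gsE[z zs <-] := ys; exists z; rewrite ?ts.
have /eq_in_map gtE : map g t = map id t by rewrite map_id.
by apply: gtE; rewrite ts.
Qed.

End FiniteStabilizer.

(** * Orbits of finite sets and left-uniform continuity *)

Section SubgroupOfOrderAut.
Variables (R : realType) (d : Order.disp_t) (X : orderType d).
Variable G : groupClosed (order_aut X).

Local Notation point_act := (order_aut_action G).
Local Notation set_act := (powerset_action point_act).

Lemma nbhs_subgroup1 (U : set (subgroup G)) :
  nbhs (1%g : subgroup G) U <-> exists2 F : set X, finite_set F &
    [set g | forall x, F x -> point_act g x = x] `<=` U.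
Proof.
split=> [[V [[W oW <-]] /= W1 VU]|[F Ffin sFU]].
  have /nbhs_order_aut[F Ffin FW] :
      nbhs (1%g : order_aut X) W by exact: open_nbhs_nbhs.
  exists F => // g gF; apply: VU; apply: FW => x /set_mem; exact: gF.
apply: filterS sFU _.
have val_cont : continuous (@subgroup_val _ G) by exact: initial_continuous.
apply: (val_cont 1%g [set h : order_aut X | forall x, F x -> h x = x]).
apply/nbhs_order_aut; exists F => // h hF x Fx.
by apply: hF; exact: mem_set.
Qed.

(** The linear order enters the proof here: a left coset of the setwise stabilizer of
    [S] is a left coset of its pointwise stabilizer. *)
Lemma eq_translate_fix (S : set X) (x y : subgroup G) : finite_set S ->
  set_act x S = set_act y S -> forall z, S z -> point_act (x^-1 * y)%g z = z.
Proof.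
move=> Sfin xy z Sz; have xS : set_act (x^-1 * y)%g S = S.
  by rewrite actM -xy -actM mulVg act1.
exact: order_aut_fix_finite Sfin xS z Sz.
Qed.

Definition orbit_pt (S : set X) (g : subgroup G) : act_orbit set_act S :=
  SigSub (mem_set (imageT (fun g => set_act g S) g)).

Lemma orbit_ptM (S : set X) (g h : subgroup G) :
  orbit_pt S (g * h)%g = orbit_action set_act S g (orbit_pt S h).
Proof. by apply: val_inj; exact: (actM set_act g h S). Qed.

(** [gS] depends only on the left coset of [g] modulo the pointwise stabilizer of
    [S], which is open because [S] is finite. *)
Lemma linfty_orbit_LUCB (S : set X) (f : act_orbit set_act S -> R) :
  finite_set S -> linfty f -> LUCB (f \o orbit_pt S).
Proof.
move=> Sfin bf; split=> [|e e0]; first exact: linfty_comp.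
exists [set g | forall x, S x -> point_act g x = x].
  by apply/nbhs_subgroup1; exists S.
move=> x y xyS; suff xyE : orbit_pt S y = orbit_pt S x.
  by rewrite /= xyE subrr normr0 ltW.
apply: val_inj; change (set_act y S = set_act x S).
have -> : y = (x * (x^-1 * y))%g by rewrite mulVKg.
rewrite actM; congr (set_act x _); apply: eq_image_id => z Sz; exact: xyS.
Qed.

Lemma orbit_section (S : set X) (y : act_orbit set_act S) :
  {g : subgroup G | orbit_pt S g = y}.
Proof.
by apply: cid; have [g _ gS] := set_valP y; exists g; apply: val_inj.
Qed.

Definition orbit_repr (S : set X) (y : act_orbit set_act S) : subgroup G :=
  sval (orbit_section y).

Lemma orbit_reprK (S : set X) (y : act_orbit set_act S) :
  orbit_pt S (orbit_repr y) = y.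
Proof. exact: svalP (orbit_section y). Qed.

(** Invariance of [mu] moves the translation by [g] from [orbit_repr y] to [y].
    Both [g * orbit_repr y] and [orbit_repr (g y)] map [S] to [g y], so they
    differ on the right by an element that fixes [S], hence [F], pointwise. *)
Lemma mean_orbit_repr_almost_invariant (S F : set X)
    (mu : (act_orbit set_act S -> R) -> R) (f : subgroup G -> R)
    (g : subgroup G) (e : R) :
  invariant_mean (orbit_action set_act S) mu -> finite_set S -> F `<=` S ->
  linfty f ->
  (forall x y, (forall z, F z -> point_act (x^-1 * y)%g z = z) ->
     `|f x - f y| <= e) ->
  `|mu ((fun x => f (g * x)%g) \o @orbit_repr S) - mu (f \o @orbit_repr S)|
     <= e.
Proof.
move=> [mean_mu inv_mu] Sfin FS bf fe.
have bs : linfty (f \o @orbit_repr S) by exact: linfty_comp.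
rewrite -(inv_mu _ bs g) -meanB//; first last.
- exact: linfty_comp.
- exact: (linfty_comp (fun y => (g * orbit_repr y)%g)).
apply: mean_norm_le => // y; apply: fe => z /FS.
apply: (eq_translate_fix Sfin).
apply: (congr1 val (_ : orbit_pt S _ = orbit_pt S _)).
by rewrite orbit_reprK orbit_ptM orbit_reprK.
Qed.

Definition finite_sets_at_infinity : set_system {fset X} :=
  filter_from setT (fun A : {fset X} => [set B : {fset X} | (A `<=` B)%fset]).

Lemma finite_sets_at_infinity_proper : ProperFilter finite_sets_at_infinity.
Proof.
apply: filter_from_proper; last by move=> A _; exists A => /=.
apply: filter_from_filter; first by exists fset0.
move=> A B _ _; exists (A `|` B)%fset => // C /=.
by rewrite fsubUset => /andP[].
Qed.

End SubgroupOfOrderAut.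

Theorem corollary3p14 (R : realType) (d : Order.disp_t) (X : orderType d)
    (G : groupClosed (order_aut X)) :
  skew_amenable R (subgroup G) <->
  forall S : set X, finite_set S ->
    exists mu : (act_orbit (powerset_action (order_aut_action G)) S -> R) -> R,
      invariant_mean (orbit_action (powerset_action (order_aut_action G)) S) mu.
Proof.
split=> [[mu mean_mu inv_mu] S Sfin|means].
  exists (fun f => mu (f \o orbit_pt S)); split.
    apply: is_mean_pushforward mean_mu => f; exact: linfty_orbit_LUCB.
  move=> f bf g; rewrite -(inv_mu (f \o orbit_pt S) _ g); last first.
    exact: linfty_orbit_LUCB.
  by congr mu; apply/funext => x /=; rewrite orbit_ptM.
have meanS (B : {fset X}) := cid (means [set` B] (finite_fset B)).
have FF := finite_sets_at_infinity_proper X.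
have [mu mean_mu eq_mu] := mean_limit
  (m := fun (B : {fset X}) f =>
    sval (meanS B) (f \o @orbit_repr _ _ G [set` B]))
  FF (fun B => is_mean_pushforward (@linfty_comp R _ _ _)
    (svalP (meanS B)).1).
exists mu.
  have [mulin mupos mu1] := mean_mu.
  split=> // [c f g [bf _] [bg _]|f [bf _]]; first exact: mulin.
  exact: mupos.
move=> f [bf fU] g; apply: eq_mu => //.
  exact: (linfty_comp (fun x => (g * x)%g)).
move=> e /fU[U /nbhs_subgroup1[F /finite_fsetP[A ->] FU] Ue].
exists A => // B /= /fsubsetP AB.
apply: (mean_orbit_repr_almost_invariant (F := [set` A])) => //.
- exact: svalP (meanS B).
- by move=> x y xy; apply: Ue; exact: FU.
Qed.
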